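(* Let $\alpha>0$, let $A$ be an $n\times n$ nonsingular $M$-matrix, $R=A^{-1}$, and let $Z=(Z_1,\ldots,Z_n)=Z_{\alpha,\overline B}$ be the associated $\mathbb{N}^n$-valued random variable. Then for every integer $m\ge 1$ and every $1\le p\le n$, $$E(Z_{p}^{m})=\sum_{l=0}^{m-1}\ \sum_{\substack{j_{0}+\cdots+j_{l}=m\\ j_{i}\ge 1}}(-1)^{l+m+1}\alpha^{j_{0}}(\alpha+1)^{j_{1}}\cdots(\alpha+l)^{j_{l}}\,(R_{p,p}A_{p,p})^{l}\,(R_{p,p}A_{p,p}-1),$$ where the inner sum is over all tuples $(j_0,\ldots,j_l)$ of integers $j_i\ge1$ with $j_0+\cdots+j_l=m$.
   Context: A real matrix $A=\{a_{i,j}\}_{1\le i,j\le n}$ is a nonsingular $M$-matrix if $a_{i,j}\le 0$ for all $i\ne j$, $A$ is nonsingular, and all entries of $A^{-1}$ are nonnegative. $|M|$ denotes the determinant of a matrix $M$. Let $a_i=a_{i,i}=A_{i,i}$ be the diagonal entries of $A$ (they are positive), let $D_A=\mathrm{diag}(a_1,\ldots,a_n)$, and write $A=D_A-B$, so $B$ has nonnegative entries and zero diagonal. Set $\overline A=D_A^{-1}A=I-\overline B$ with $\overline B=D_A^{-1}B$. For $\alpha>0$ the $\alpha$-permanent of an $n\times n$ matrix $M$ is $|M|_\alpha=\sum_{\pi}\alpha^{c(\pi)}M_{1,\pi(1)}M_{2,\pi(2)}\cdots M_{n,\pi(n)}$, where the sum is over all permutations $\pi$ of $\{1,\ldots,n\}$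 and $c(\pi)$ is the number of cycles of $\pi$. $\mathbb{N}=\{0,1,2,\ldots\}$. For ${\bf k}=(k_1,\ldots,k_n)\in\mathbb{N}^n$ put $|{\bf k}|=\sum_l k_l$, and for $1\le m\le|{\bf k}|$ let $i_m=j$ where $j$ is determined by $\sum_{l=1}^{j-1}k_l<m\le\sum_{l=1}^{j}k_l$. For an $n\times n$ matrix $C=\{c_{i,j}\}$, $C({\bf k})$ is the $|{\bf k}|\times|{\bf k}|$ matrix with $(p,q)$ entry $c_{i_p,i_q}$; by convention $|C({\bf 0})|_\alpha=1$. $Z=Z_{\alpha,\overline B}$ is an $\mathbb{N}^n$-valued random variable with distribution $P(Z=(k_1,\ldots,k_n))=|\overline A|^{\alpha}\,\dfrac{|\overline B({\bf k})|_\alpha}{\prod_{i=1}^n k_i!}$ (these probabilities sum to 1). *)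

(* Defs.v *)
From HB Require Import structures.
From mathcomp Require Import all_boot all_order all_fingroup all_algebra.
From mathcomp Require Import all_classical all_reals all_analysis.
Set Implicit Arguments.
Unset Strict Implicit.
Unset Printing Implicit Defensive.
Import Order.TTheory GRing.Theory Num.Theory.
Local Open Scope ring_scope.

Definition nonsingular_M_matrix (R : realType) (n : nat) (A : 'M[R]_n) : Prop :=
  [/\ forall i j, i != j -> A i j <= 0,
      A \in unitmx
    & forall i j, 0 <= invmx A i j].

(* [porbits s] is the set of all cycles of [s], fixed points included. *)
Definition alpha_permanent (R : realType) (alpha : R) (n : nat) (M : 'M[R]_n) : R :=
  \sum_(s : 'S_n) alpha ^+ #|porbits s| * \prod_(i < n) M i (s i).

(* [tagnat.sig1] sends an index of the concatenation of n blocks of sizes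
   k_0, ..., k_(n-1) to its block; [tagnat_sig1P] gives the explicit bounds. *)
Definition blowup_mx (R : realType) (n : nat) (C : 'M[R]_n) (k : n.-tuple nat) :
    'M[R]_(\sum_(l < n) tnth k l) :=
  \matrix_(p, q) C (tagnat.sig1 p) (tagnat.sig1 q).

(* With 0-based indices this is
   k_0 + ... + k_(j-1) <= m < k_0 + ... + k_j  where  j = sig1 m. *)
Lemma tagnat_sig1P (n : nat) (k : n.-tuple nat) (m : 'I_(\sum_(l < n) tnth k l)) :
  (\sum_(l < n | (l < tagnat.sig1 m)%N) tnth k l <= m
     < \sum_(l < n | (l <= tagnat.sig1 m)%N) tnth k l)%N.
Proof.
have -> : (\sum_(l < n | (l <= tagnat.sig1 m)%N) tnth k l =
    \sum_(l < n | (l < tagnat.sig1 m)%N) tnth k l + tnth k (tagnat.sig1 m))%N.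
  rewrite (bigD1 (tagnat.sig1 m)) //= addnC; congr (_ + _)%N.
  by apply: eq_bigl => l; rewrite andbC ltn_neqAle.
by rewrite [X in (_ <= X < _)%N]tagnat.rect leq_addr ltn_add2l ltn_ord.
Qed.

Definition diag_part (R : realType) (n : nat) (A : 'M[R]_n) : 'M[R]_n :=
  diag_mx (\row_i A i i).

(* A bar = D_A^-1 A *)
Definition scaled_mx (R : realType) (n : nat) (A : 'M[R]_n) : 'M[R]_n :=
  invmx (diag_part A) *m A.

(* B bar = D_A^-1 B, where A = D_A - B *)
Definition scaled_offdiag (R : realType) (n : nat) (A : 'M[R]_n) : 'M[R]_n :=
  invmx (diag_part A) *m (diag_part A - A).

Definition permanental_pmf (R : realType) (alpha : R) (n : nat) (A : 'M[R]_n)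
    (k : n.-tuple nat) : R :=
  \det (scaled_mx A) `^ alpha *
  (alpha_permanent alpha (blowup_mx (scaled_offdiag A) k)
     / (\prod_(i < n) (tnth k i)`!)%:R).

(* Main.v *)
Require Import Defs.
From HB Require Import structures.
From mathcomp Require Import all_boot all_order all_fingroup all_algebra.
From mathcomp Require Import all_classical all_reals all_analysis.
From mathcomp Require Import ring lra zify.
Import Order.TTheory GRing.Theory Num.Theory.
Import numFieldNormedType.Exports.
Local Open Scope ring_scope.
Set Implicit Arguments.
Unset Strict Implicit.
Unset Printing Implicit Defensive.

(** The law of [Z_p] is negative binomial with parameters [alpha] and
    [1 - 1/c], where [c = R_pp A_pp], and the formula holds because rising
    factorials of [Z_p + alpha] have explicit expectations under this law. No
    generating function is computed: only the balance equation
    [c (a + 1) h_(a+1) = (c - 1) (alpha + a) h_a], with [h_a = P(Z_p = a)], is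
    proved, and it suffices.

    Balance equation. Up to constants and factorials, the weight of [k] sums,
    over all configurations of disjoint cycles that visit index [i] exactly
    [k_i] times, the product of the entries of B-bar along the cycles, times
    [alpha] for each cycle. Consider also the configurations that contain one
    open path from [p] to [j]. Two linear relations hold. Removing the last
    step of the path is the splicing expansion [alpha_permanent_expand0]
    ([open_permanent_rec], [path_mass_rec]). Cutting a cycle at a visit of [p]
    gives a path from [p] to [p], since the letter that closes such a path is a
    visit of [p] ([closed_permanent_cut], [cycle_mass_cut]). Summed over all
    [k] with [k_p = a], they form a linear system with matrix [I - B-bar],
    whose inverse [A^-1 D_A] is nonnegative and has entry [c] at [(p, p)];
    solving it gives the equation ([mass_balance]).

    Moments. Let [s_l(x)] be the product over [i < l] of
    [(x + alpha + i) / (alpha + i)]. Testing the balance equation against [s_l]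
    gives [E s_l(Z_p) = c ^ l] and
    [E (Z_p s_l(Z_p)) = (alpha + l) (c - 1) c ^ l] ([rising_ratio_moments]).
    Writing [Z_p ^ m] as [Z_p] times [Z_p ^ (m-1)] and expanding the second
    factor on the [s_l] by Newton interpolation ([exprn_rising_ratio]), the
    coefficients are, up to sign and normalisation, the sums over compositions
    of [m] that appear in the statement ([composition_sumE]). *)

(** * Expansion of the alpha-permanent along its first row and column *)

Lemma card_porbits_lift0 (n : nat) (s : 'S_n) :
  #|porbits (lift_perm ord0 ord0 s)| = #|porbits s|.+1.
Proof.
set s' := lift_perm _ _ s.
have iter_lift k x : (s' ^+ k)%g (lift ord0 x) = lift ord0 ((s ^+ k)%g x).
  by elim: k x => [|k IHk] x; rewrite ?perm1 // !expgS !permM lift_perm_lift IHk.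
have iter0 k : (s' ^+ k)%g ord0 = ord0.
  by elim: k => [|k IHk]; rewrite ?perm1 // !expgS !permM lift_perm_id IHk.
have orbit0 : porbit s' ord0 = [set ord0].
  apply/setP => y; rewrite inE; apply/porbitP/eqP => [[k]|->].
    by rewrite iter0.
  by exists 0%N; rewrite iter0.
have orbit_lift x : porbit s' (lift ord0 x) = lift ord0 @: porbit s x.
  apply/setP => y; apply/porbitP/imsetP => [[k ->]|[z /porbitP[k ->] ->]].
    by exists ((s ^+ k)%g x); [by apply/porbitP; exists k | rewrite iter_lift].
  by exists k; rewrite iter_lift.
have -> : porbits s' =
    [set ord0] |: [set (lift ord0 @: (C : {set 'I_n})) | C in porbits s].
  apply/setP => C; rewrite !inE; apply/imsetP/idP => [[x _ ->]|].
    case: (unliftP ord0 x) => [y ->|->]; last by rewrite orbit0 eqxx.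
    rewrite orbit_lift; apply/orP; right; apply/imsetP.
    by exists (porbit s y) => //; apply/imsetP; exists y.
  case/orP => [/eqP->|/imsetP[_ /imsetP[x _ ->] ->]].
    by exists ord0; rewrite ?orbit0.
  by exists (lift ord0 x); rewrite ?orbit_lift.
rewrite cardsU1 card_imset; last exact/imset_inj/lift_inj.
rewrite -[RHS]add1n; congr (_ + _)%N; rewrite (_ : (_ \notin _) = true) //.
apply/imsetP => -[C _ /setP/(_ ord0)]; rewrite !inE eqxx => /esym/imsetP[x _].
by move/eqP; rewrite (negPf (neq_lift _ _)).
Qed.

(** Inserting the new point 0 into the cycle through [t] creates no cycle: by
    the lemma on products with transpositions, two cycles merge into one. *)
Lemma card_porbits_insert0 (n : nat) (s : 'S_n) (t : 'I_n) :
  #|porbits (tperm ord0 (lift ord0 t) * lift_perm ord0 ord0 s)%g| = #|porbits s|.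
Proof.
have := porbits_mul_tperm (lift_perm ord0 ord0 s) ord0 (lift ord0 t).
cbv zeta; rewrite card_porbits_lift0 neq_lift.
rewrite (_ : (_ \notin _) = true) ?addn2 ?addn1 => [[]|] //.
apply/negP => /porbitP[k]; elim: k t => [|k IHk] t.
  by rewrite perm1 => /eqP; rewrite (negPf (neq_lift _ _)).
by rewrite expgS permM lift_perm_lift => /IHk.
Qed.

(** A permutation of n+1 points is a permutation of the n nonzero ones into
    which 0 is inserted, either as a fixed point or inside an existing cycle;
    the inverse image of 0 tells where. *)
Lemma reindex_insert0 (R : nmodType) (n : nat) (F : 'S_n.+1 -> R) :
  \sum_s F s =
  \sum_(s : 'S_n) (F (lift_perm ord0 ord0 s) +
    \sum_t F (tperm ord0 (lift ord0 t) * lift_perm ord0 ord0 s)%g).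
Proof.
pose G (u : 'S_n * 'I_n.+1) := (tperm ord0 u.2 * lift_perm ord0 ord0 u.1)%g.
have G_inj : injective G.
  move=> [s1 y1] [s2 y2] /= eqG.
  have eqy : y1 = y2.
    apply: (@perm_inj _ (G (s1, y1))); rewrite {2}eqG /G /= !permM !tpermR.
    by rewrite !lift_perm_id.
  congr pair => //; apply/permP => x; apply: (@lift_inj _ ord0).
  move: eqG; rewrite /G /= eqy => /mulgI/permP/(_ (lift ord0 x)).
  by rewrite !lift_perm_lift.
have G_bij : bijective G.
  apply: inj_card_bij => //; rewrite card_prod !card_Sn card_ord.
  by rewrite factS mulnC.
rewrite (reindex G); last exact: onW_bij.
rewrite -(pair_bigA _ (fun s y => F (G (s, y)))) /=; apply: eq_bigr => s _.
rewrite big_ord_recl; congr (_ + _); congr F.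
by rewrite /G /= tperm1 mul1g.
Qed.

(** The analogue of the Laplace expansion. A fixed point 0 is one more cycle
    and costs [alpha]; otherwise 0 is spliced out of its cycle, and the point
    [t] whose image was 0 inherits the entries of row 0. *)
Lemma alpha_permanent_expand0 (R : realType) (alpha : R) (n : nat)
    (M : 'M[R]_n.+1) :
  alpha_permanent alpha M =
    alpha * M ord0 ord0 *
      alpha_permanent alpha (\matrix_(x < n, y < n) M (lift ord0 x) (lift ord0 y))
    + \sum_t alpha_permanent alpha (\matrix_(x < n, y < n)
        (if x == t then M (lift ord0 t) ord0 * M ord0 (lift ord0 y)
         else M (lift ord0 x) (lift ord0 y))).
Proof.
rewrite /alpha_permanent reindex_insert0 big_split /=; congr (_ + _).
  rewrite mulr_sumr; apply: eq_bigr => s _.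
  rewrite card_porbits_lift0 big_ord_recl lift_perm_id exprS.
  under [\prod_(i < n) _]eq_bigr do rewrite lift_perm_lift.
  under [in RHS]eq_bigr do rewrite mxE.
  by rewrite mulrACA.
rewrite exchange_big; apply: eq_bigr => t _; apply: eq_bigr => s _.
rewrite card_porbits_insert0; congr (_ * _).
rewrite big_ord_recl (bigD1 t) //= [in RHS](bigD1 t) //= mxE eqxx.
rewrite !permM tpermL tpermR lift_perm_id lift_perm_lift mulrA [M _ _ * M _ _]mulrC.
congr (_ * _); apply: eq_bigr => x xt; rewrite mxE (negPf xt) permM tpermD.
- by rewrite lift_perm_lift.
- by rewrite neq_lift.
- by rewrite (inj_eq lift_inj) eq_sym.
Qed.

Lemma alpha_permanent_conj (R : realType) (alpha : R) (n : nat)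
    (M : 'M[R]_n) (p : 'S_n) :
  alpha_permanent alpha (\matrix_(x, y) M (p x) (p y)) = alpha_permanent alpha M.
Proof.
rewrite /alpha_permanent (reindex (fun s => s ^ p^-1)%g); last first.
  by exists (fun s => s ^ p)%g => s _; rewrite -conjgM ?mulgV ?mulVg conjg1.
apply: eq_bigr => s _; congr (_ ^+ _ * _).
  have orbitJ x : porbit (s ^ p^-1)%g x = p^-1%g @: porbit s (p x).
    apply/setP => y; apply/porbitP/imsetP => [[k ->]|[_ /porbitP[k ->] ->]].
      exists ((s ^+ k)%g (p x)); first by apply/porbitP; exists k.
      by rewrite -conjXg conjgE !permM invgK.
    by exists k; rewrite -conjXg conjgE !permM invgK.
  rewrite -[RHS](card_imset _ (imset_inj (@perm_inj _ p^-1%g))).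
  apply: eq_card => C; apply/imsetP/imsetP => [[x _ ->]|[_ /imsetP[x _ ->] ->]].
    by exists (porbit s (p x)); rewrite ?orbitJ //; apply/imsetP; exists (p x).
  by exists (p^-1 x)%g; rewrite ?orbitJ ?permKV.
rewrite [RHS](reindex_inj (@perm_inj _ p)); apply: eq_bigr => x _.
by rewrite mxE conjgE !permM invgK permKV.
Qed.

(** * Configurations of cycles and paths on words *)

(** A letter is a point of the permuted set, which carries two indices of [B]:
    one for its row and one for its column. Splicing a point out of a cycle
    turns letters [(x, x)] into mixed letters, so words of pairs are what the
    expansion stays within. *)
Definition letter_permanent (R : realType) (alpha : R) (n : nat) (B : 'M[R]_n)
    (d : 'I_n * 'I_n) (s : seq ('I_n * 'I_n)) : R :=
  alpha_permanent alpha
    (\matrix_(x < size s, y < size s) B (nth d s x).1 (nth d s y).2).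

(** Permuting the word conjugates the permutations, which keeps the number of
    cycles; hence only the multiplicities of the letters matter. *)
Lemma letter_permanent_perm (R : realType) (alpha : R) (n : nat) (B : 'M[R]_n)
    (d : 'I_n * 'I_n) (s t : seq ('I_n * 'I_n)) :
  perm_eq s t -> letter_permanent alpha B d s = letter_permanent alpha B d t.
Proof.
move=> st; rewrite /letter_permanent (perm_size st).
case/(@tuple_permP _ _ _ (in_tuple t)): st => p def_s.
rewrite -[RHS](alpha_permanent_conj _ _ p); congr alpha_permanent.
apply/matrixP => x y; rewrite !mxE def_s.
by rewrite -!(tnth_nth d [tuple tnth (in_tuple t) (p i) | i < size t]) !tnth_mktuple
  !(tnth_nth d).
Qed.

Lemma alpha_permanent_scale_row (R : realType) (alpha a : R) (n : nat)
    (M : 'M[R]_n) (t : 'I_n) :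
  alpha_permanent alpha (\matrix_(x, y) ((if x == t then a else 1) * M x y)) =
  a * alpha_permanent alpha M.
Proof.
rewrite /alpha_permanent mulr_sumr; apply: eq_bigr => s _.
rewrite mulrCA; congr (_ * _).
rewrite (bigD1 t) //= [in RHS](bigD1 t) //= mxE eqxx -mulrA; congr (_ * (_ * _)).
by apply: eq_bigr => x /negPf xt; rewrite mxE xt mul1r.
Qed.

Lemma letter_permanent_cons (R : realType) (alpha : R) (n : nat) (B : 'M[R]_n)
    (d : 'I_n * 'I_n) (r c : 'I_n) (s : seq ('I_n * 'I_n)) :
  letter_permanent alpha B d ((r, c) :: s) =
    alpha * B r c * letter_permanent alpha B d s +
    \sum_(t < size s) B (nth d s t).1 c *
      letter_permanent alpha B d (set_nth d s t (r, (nth d s t).2)).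
Proof.
rewrite {1}/letter_permanent alpha_permanent_expand0 !mxE; congr (_ * _ + _).
  by congr alpha_permanent; apply/matrixP => x y; rewrite !mxE.
apply: eq_bigr => t _.
have size_set : size (set_nth d s t (r, (nth d s t).2)) = size s.
  by rewrite size_set_nth; apply/maxn_idPr.
rewrite /letter_permanent size_set -(alpha_permanent_scale_row _ _ _ t).
congr alpha_permanent; apply/matrixP => x y; rewrite !mxE !nth_set_nth /=.
rewrite !(inj_eq val_inj); case: (x =P t) => _;
  by case: (y =P t) => [->|_]; rewrite ?mul1r.
Qed.

Lemma perm_set_nth (T : eqType) (d : T) (s : seq T) (t : nat) (v : T) :
  (t < size s)%N -> perm_eq (set_nth d s t v) (v :: rem (nth d s t) s).
Proof.
move=> ts; rewrite set_nthE ts perm_catC /= perm_cons.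
rewrite -(perm_cons (nth d s t)).
apply: perm_trans (perm_to_rem (mem_nth d ts)).
by rewrite -[X in perm_eq _ X](cat_take_drop t) (drop_nth d ts) perm_sym perm_catC.
Qed.

(** [alpha] times the weight of the configurations made of closed cycles and of
    one open path, from [i] to [j], that together visit the letters of [f]:
    the extra letter [(i, j)] closes the path. *)
Definition open_permanent (R : realType) (alpha : R) (n : nat) (B : 'M[R]_n)
    (i j : 'I_n) (f : seq 'I_n) : R :=
  letter_permanent alpha B (i, i) ((i, j) :: [seq (x, x) | x <- f]).

Definition closed_permanent (R : realType) (alpha : R) (n : nat) (B : 'M[R]_n)
    (i : 'I_n) (f : seq 'I_n) : R :=
  letter_permanent alpha B (i, i) [seq (x, x) | x <- f].

Lemma open_permanent_perm (R : realType) (alpha : R) (n : nat) (B : 'M[R]_n)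
    (i j : 'I_n) (f g : seq 'I_n) : perm_eq f g ->
  open_permanent alpha B i j f = open_permanent alpha B i j g.
Proof. by move=> fg; apply: letter_permanent_perm; rewrite perm_cons perm_map. Qed.

(** Last-step decomposition of the open path: it jumps directly from [i] to
    [j], or its last visited letter is some [x], and the path up to [x] is an
    open path in the word deprived of [x]. *)
Lemma open_permanent_rec (R : realType) (alpha : R) (n : nat) (B : 'M[R]_n)
    (i j : 'I_n) (f : seq 'I_n) :
  open_permanent alpha B i j f = alpha * B i j * closed_permanent alpha B i f +
    \sum_(x <- f) B x j * open_permanent alpha B i x (rem x f).
Proof.
rewrite /open_permanent letter_permanent_cons; congr (_ + _).
rewrite (big_nth i) big_mkord size_map; apply: eq_bigr => t _.
have tf : (t < size f)%N by [].
rewrite (nth_map i) //=; congr (_ * _); apply: letter_permanent_perm.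
apply: (perm_trans (perm_set_nth _ _ _)); first by rewrite size_map.
rewrite perm_cons (nth_map i) //.
have inj : injective (fun x : 'I_n => (x, x)) by move=> x y [].
rewrite -(perm_cons (nth i f t, nth i f t)).
rewrite perm_sym -[_ :: map _ _]/(map (fun x => (x, x)) (_ :: _)).
apply: (@perm_trans _ [seq (x, x) | x <- f]).
  by rewrite perm_map // perm_sym perm_to_rem // mem_nth.
by apply: perm_to_rem; rewrite map_f // mem_nth.
Qed.

(** Cutting at a letter [i] the cycle that contains it gives an open path from
    [i] to [i]. *)
Lemma closed_permanent_cut (R : realType) (alpha : R) (n : nat) (B : 'M[R]_n)
    (i : 'I_n) (f : seq 'I_n) :
  i \in f -> closed_permanent alpha B i f = open_permanent alpha B i i (rem i f).
Proof.
move=> fi; apply: letter_permanent_perm.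
by rewrite -[(i, i) :: _]/(map (fun x => (x, x)) (_ :: _)) perm_map // perm_to_rem.
Qed.

Lemma alpha_permanent_ge0 (R : realType) (alpha : R) (n : nat) (M : 'M[R]_n) :
  0 <= alpha -> (forall i j, 0 <= M i j) -> 0 <= alpha_permanent alpha M.
Proof.
move=> a0 M0; apply: sumr_ge0 => s _; rewrite mulr_ge0 ?exprn_ge0 //.
exact: prodr_ge0.
Qed.

Lemma open_permanent_ge0 (R : realType) (alpha : R) (n : nat) (B : 'M[R]_n)
    (i j : 'I_n) (f : seq 'I_n) : 0 <= alpha -> (forall i j, 0 <= B i j) ->
  0 <= open_permanent alpha B i j f.
Proof. by move=> a0 B0; apply: alpha_permanent_ge0 => // x y; rewrite mxE. Qed.

(** * Generating weights indexed by multiplicities *)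

Definition incr_at (n : nat) (l : 'I_n) (k : n.-tuple nat) : n.-tuple nat :=
  [tuple (tnth k i + (i == l))%N | i < n].

Definition decr_at (n : nat) (l : 'I_n) (k : n.-tuple nat) : n.-tuple nat :=
  [tuple (tnth k i - (i == l))%N | i < n].

Lemma incr_atK (n : nat) (l : 'I_n) : cancel (incr_at l) (decr_at l).
Proof. by move=> k; apply: eq_from_tnth => i; rewrite !tnth_mktuple addnK. Qed.

Lemma decr_atK (n : nat) (l : 'I_n) (k : n.-tuple nat) :
  (0 < tnth k l)%N -> incr_at l (decr_at l k) = k.
Proof.
move=> kl; apply: eq_from_tnth => i; rewrite !tnth_mktuple.
by case: eqP => [->|_]; rewrite ?subn0 ?addn0 ?subnK.
Qed.

Definition block_word (n : nat) (k : n.-tuple nat) : seq 'I_n :=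
  [seq tagnat.sig1 i | i <- enum 'I_(\sum_(l < n) tnth k l)].

Lemma count_block_word (n : nat) (k : n.-tuple nat) (l : 'I_n) :
  count_mem l (block_word k) = tnth k l.
Proof.
rewrite /block_word count_map -sum1_count big_enum_cond big_mkcond /=.
rewrite (reindex _ tagnat.rank_bij_on) /=.
transitivity (\sum_(i < n) \sum_(j < tnth k i) (i == l))%N.
  rewrite sig_big_dep; apply: eq_bigr => q _.
  by rewrite /tagnat.sig1 tagnat.rankK; case: eqP.
rewrite (bigD1 l) //= [X in (_ + X)%N]big1 ?addn0; last first.
  by move=> i /negPf il; rewrite il big1.
by rewrite eqxx sum_nat_const muln1 card_ord.
Qed.

Lemma prod_fact_decr (n : nat) (l : 'I_n) (k : n.-tuple nat) :
  (0 < tnth k l)%N ->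
  (\prod_(i < n) (tnth k i)`! = tnth k l * \prod_(i < n) (tnth (decr_at l k) i)`!)%N.
Proof.
move=> kl; rewrite (bigD1 l) // [in RHS](bigD1 l) //= mulnA; congr (_ * _)%N.
  by rewrite tnth_mktuple eqxx subn1 -[in LHS](prednK kl) factS prednK.
by apply: eq_bigr => i /negPf il; rewrite tnth_mktuple il subn0.
Qed.

Lemma prod_fact_neq0 (R : numDomainType) (n : nat) (k : n.-tuple nat) :
  (\prod_(i < n) (tnth k i)`!)%:R != 0 :> R.
Proof. by rewrite pnatr_eq0 -lt0n prodn_gt0 // => i; exact: fact_gt0. Qed.

(** With multiplicities as indices, deleting a letter is lowering one
    coordinate. *)
Lemma perm_block_word_decr (n : nat) (l : 'I_n) (k : n.-tuple nat) :
  perm_eq (rem l (block_word k)) (block_word (decr_at l k)).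
Proof.
apply/allP => x _; apply/eqP; rewrite /= count_rem !count_block_word tnth_mktuple.
rewrite -has_pred1 has_count count_block_word.
by case: (x =P l) => [->|/eqP /negPf xl]; rewrite /= ?eqxx ?andbT 1?eq_sym ?xl
  ?andbF //; case: (tnth k l).
Qed.

Lemma sum_block_word (R : pzSemiRingType) (n : nat) (k : n.-tuple nat) (F : 'I_n -> R) :
  \sum_(x <- block_word k) F x = \sum_l (tnth k l)%:R * F l.
Proof.
rewrite (partition_big id predT) //=; apply: eq_bigr => l _.
rewrite -(count_block_word k l) mulr_natl -sum1_count -sumrMnr.
by apply: eq_bigr => x /eqP ->; rewrite mulr1n.
Qed.

Lemma mem_block_word (n : nat) (k : n.-tuple nat) (l : 'I_n) :
  (l \in block_word k) = (0 < tnth k l)%N.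
Proof. by rewrite -has_pred1 has_count count_block_word. Qed.

Definition cycle_mass (R : realType) (alpha : R) (n : nat) (B : 'M[R]_n)
    (k : n.-tuple nat) : R :=
  alpha_permanent alpha (blowup_mx B k) / (\prod_(i < n) (tnth k i)`!)%:R.

(** The division by [alpha] cancels the weight of the cycle that closes the
    path in [open_permanent]. *)
Definition path_mass (R : realType) (alpha : R) (n : nat) (B : 'M[R]_n)
    (i j : 'I_n) (k : n.-tuple nat) : R :=
  open_permanent alpha B i j (block_word k) /
    (alpha * (\prod_(i < n) (tnth k i)`!)%:R).

Lemma cycle_massE (R : realType) (alpha : R) (n : nat) (B : 'M[R]_n) (i : 'I_n)
    (k : n.-tuple nat) :
  cycle_mass alpha B k =
  closed_permanent alpha B i (block_word k) / (\prod_(i < n) (tnth k i)`!)%:R.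
Proof.
rewrite /cycle_mass /closed_permanent /letter_permanent; congr (_ / _).
have e : size [seq (x, x) | x <- block_word k] = (\sum_(l < n) tnth k l)%N.
  by rewrite /block_word 2!size_map size_enum_ord.
rewrite e; congr alpha_permanent; apply/matrixP => x y.
have nth_word (z : 'I_(\sum_(l < n) tnth k l)) :
    nth (i, i) [seq (x, x) | x <- block_word k] z =
    (tagnat.sig1 z, tagnat.sig1 z).
  rewrite /block_word -map_comp (nth_map z) ?size_enum_ord //.
  by rewrite nth_ord_enum.
by rewrite !mxE !nth_word.
Qed.

(** Marking one of the [k_i] letters [i] and cutting its cycle there. The
    factorials absorb the number of choices of the marked letter. *)
Lemma cycle_mass_cut (R : realType) (alpha : R) (n : nat) (B : 'M[R]_n) (i : 'I_n)
    (k : n.-tuple nat) : alpha != 0 -> (0 < tnth k i)%N ->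
  (tnth k i)%:R * cycle_mass alpha B k = alpha * path_mass alpha B i i (decr_at i k).
Proof.
move=> a0 ki; rewrite (cycle_massE _ _ i) closed_permanent_cut ?mem_block_word //.
rewrite (open_permanent_perm _ _ _ _ (perm_block_word_decr i k)) /path_mass.
have k0 := prod_fact_neq0 R (decr_at i k).
rewrite (prod_fact_decr ki) natrM; field.
by rewrite a0 k0 pnatr_eq0 -lt0n.
Qed.

Lemma path_mass_rec (R : realType) (alpha : R) (n : nat) (B : 'M[R]_n) (i j : 'I_n)
    (k : n.-tuple nat) : alpha != 0 ->
  path_mass alpha B i j k = B i j * cycle_mass alpha B k +
    \sum_(l | (0 < tnth k l)%N) B l j * path_mass alpha B i l (decr_at l k).
Proof.
move=> a0; rewrite /path_mass open_permanent_rec sum_block_word (cycle_massE _ _ i).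
have k0 := prod_fact_neq0 R k.
rewrite mulrDl; congr (_ + _); first by field; rewrite a0 k0.
rewrite mulr_suml [RHS]big_mkcond; apply: eq_bigr => l _.
case: ifP => [kl|]; last by rewrite lt0n => /negbFE/eqP ->; rewrite !mul0r.
rewrite (open_permanent_perm _ _ _ _ (perm_block_word_decr l k)).
have dk0 := prod_fact_neq0 R (decr_at l k).
rewrite (prod_fact_decr kl) natrM; field.
by rewrite a0 dk0 pnatr_eq0 -lt0n.
Qed.

Lemma cycle_mass_ge0 (R : realType) (alpha : R) (n : nat) (B : 'M[R]_n)
    (k : n.-tuple nat) : 0 <= alpha -> (forall i j, 0 <= B i j) ->
  0 <= cycle_mass alpha B k.
Proof.
move=> a0 B0; rewrite divr_ge0 ?ler0n //.
by apply: alpha_permanent_ge0 => // i j; rewrite mxE.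
Qed.

Lemma path_mass_ge0 (R : realType) (alpha : R) (n : nat) (B : 'M[R]_n) (i j : 'I_n)
    (k : n.-tuple nat) : 0 <= alpha -> (forall i j, 0 <= B i j) ->
  0 <= path_mass alpha B i j k.
Proof. by move=> a0 B0; rewrite divr_ge0 ?mulr_ge0 ?ler0n ?open_permanent_ge0. Qed.

(** * Sums over boxes, and limits of monotone sequences *)

Definition box (n N : nat) : seq (n.-tuple nat) :=
  [seq [tuple (f i : nat) | i < n] | f : {ffun 'I_n -> 'I_N.+1}].

Lemma mem_box (n N : nat) (k : n.-tuple nat) :
  (k \in box n N) = [forall i, (tnth k i <= N)%N].
Proof.
apply/mapP/forallP => [[f _ ->] i|kN].
  by rewrite tnth_mktuple -ltnS.
exists [ffun i => inord (tnth k i)]; first by rewrite mem_enum.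
by apply: eq_from_tnth => i; rewrite tnth_mktuple ffunE inordK // ltnS.
Qed.

Lemma box_uniq (n N : nat) : uniq (box n N).
Proof.
rewrite map_inj_uniq ?enum_uniq // => f g fg; apply/ffunP => i; apply: val_inj.
by have := congr1 (fun k => tnth k i) fg; rewrite !tnth_mktuple.
Qed.

(** A nonnegative sum does not decrease when its terms are mapped injectively
    among those of another sum; all comparisons between boxes follow. *)
Lemma ler_sum_inj_seq (R : numDomainType) (T : eqType) (r1 r2 : seq T)
    (P Q : pred T) (g : T -> T) (F : T -> R) :
  uniq r1 -> {in [pred x | P x] &, injective g} ->
  (forall x, x \in r1 -> P x -> g x \in r2 /\ Q (g x)) -> (forall x, 0 <= F x) ->
  \sum_(x <- r1 | P x) F (g x) <= \sum_(x <- r2 | Q x) F x.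
Proof.
move=> r1_uniq g_inj gP F0; rewrite -big_filter -[leRHS]big_filter -(big_map g predT).
have : {subset map g (seq.filter P r1) <= seq.filter Q r2}.
  move=> _ /mapP[x + ->]; rewrite !mem_filter => /andP[Px xr].
  by have [-> ->] := gP x xr Px.
have : uniq (map g (seq.filter P r1)).
  rewrite map_inj_in_uniq ?filter_uniq // => x y.
  by rewrite !mem_filter => /andP[Px _] /andP[Py _]; apply: g_inj.
elim: (map _ _) (seq.filter Q r2) => [|x s IHs] t /= => [_ _|/andP[xs us] st].
  by rewrite big_nil sumr_ge0.
have xt : x \in t by rewrite st ?mem_head.
rewrite big_cons [leRHS](big_rem x) //= lerD2l IHs // => y ys.
have yx : y != x by apply: contraNneq xs => <-.
have := st y; rewrite inE ys orbT => /(_ isT) yt.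
by move: yt; rewrite (perm_mem (perm_to_rem xt)) inE (negPf yx).
Qed.

Lemma cvg_sum (R : realType) (I : Type) (r : seq I) (P : pred I)
    (u : I -> nat -> R) (l : I -> R) :
  (forall i, P i -> (u i @ \oo --> l i)%classic) ->
  ((fun N => \sum_(i <- r | P i) u i N) @ \oo --> \sum_(i <- r | P i) l i)%classic.
Proof.
move=> ul; elim: r => [|i r IHr].
  by rewrite big_nil; under eq_fun do rewrite big_nil; apply: cvg_cst.
rewrite big_cons; under eq_fun do rewrite big_cons.
by case: ifP => Pi //; apply: cvgD; [apply: ul | apply: IHr].
Qed.

Lemma cvg_seq_le (R : realType) (u v : nat -> R) (l l' : R) :
  (u @ \oo --> l)%classic -> (v @ \oo --> l')%classic ->
  (forall N, u N <= v N) -> l <= l'.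
Proof. by move=> ul vl' uv; apply: (ler_cvg_to ul vl'); apply: nearW. Qed.

Lemma nondecreasing_bounded_cvg (R : realType) (u : nat -> R) (M : R) :
  (forall N, u N <= u N.+1) -> (forall N, u N <= M) ->
  exists l : R, (u @ \oo --> l)%classic.
Proof.
move=> u_nd uM; exists (sup (range u)); apply: nondecreasing_cvgn.
  exact/nondecreasing_seqP.
by exists M => _ [N _ <-].
Qed.

(** * The balance equation for one coordinate *)

Lemma box_sum_le (R : numDomainType) (n : nat) (p : 'I_n) (b N : nat)
    (F : n.-tuple nat -> R) : (forall k, 0 <= F k) ->
  \sum_(k <- box n N | tnth k p == b) F k <=
  \sum_(k <- box n N.+1 | tnth k p == b) F k.
Proof.
move=> F_ge0; apply: (ler_sum_inj_seq (g := id)) => //; first exact: box_uniq.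
move=> k kN kb; split => //; move: kN; rewrite !mem_box => /forallP kN.
by apply/forallP => i; apply: leqW.
Qed.

(** Lowering coordinate [l] maps a part of a box into that box, and covers
    the box whose side is smaller by one. This lemma and the next one sandwich
    the lowered sums between two sums that have the same limit; the coordinate
    [p], which is prescribed, moves only when [l = p]. *)
Lemma box_sum_decr_ge (R : numDomainType) (n : nat) (p l : 'I_n) (b N : nat)
    (F : n.-tuple nat -> R) : (forall k, 0 <= F k) ->
  \sum_(k <- box n N | tnth k p == b) F k <=
  \sum_(k <- box n N.+1 | (tnth k p == b + (p == l))%N && (0 < tnth k l)%N)
    F (decr_at l k).
Proof.
move=> F_ge0; rewrite -(eq_bigr _ (fun k _ => congr1 F (incr_atK l k))).
apply: (@ler_sum_inj_seq _ _ _ _ _ _ (incr_at l) (fun k => F (decr_at l k))).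
- exact: box_uniq.
- by move=> k1 k2 _ _; apply: (can_inj (incr_atK l)).
- move=> k kN /eqP kb; rewrite !tnth_mktuple !eqxx kb addn1 eqxx; split => //.
  move: kN; rewrite !mem_box => /forallP kN; apply/forallP => i.
  by rewrite tnth_mktuple (leq_trans (leq_add (kN i) (leq_b1 _))) // addn1.
- by move=> k.
Qed.

Lemma box_sum_decr_le (R : numDomainType) (n : nat) (p l : 'I_n) (b N : nat)
    (F : n.-tuple nat -> R) : (forall k, 0 <= F k) ->
  \sum_(k <- box n N | (tnth k p == b + (p == l))%N && (0 < tnth k l)%N)
    F (decr_at l k) <=
  \sum_(k <- box n N | tnth k p == b) F k.
Proof.
move=> F_ge0; apply: ler_sum_inj_seq => //.
- exact: box_uniq.
- move=> k1 k2 /andP[_ k1l] /andP[_ k2l] /(congr1 (incr_at l)).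
  by rewrite !decr_atK.
- move=> k kN /andP[/eqP kb kl]; rewrite tnth_mktuple kb addnK eqxx; split => //.
  move: kN; rewrite !mem_box => /forallP kN; apply/forallP => i.
  by rewrite tnth_mktuple (leq_trans (leq_subr _ _)).
Qed.

(** A row vector is recovered from its residual under [1 - B] by the inverse
    matrix; as that inverse is nonnegative, bounds on residuals are bounds on
    vectors. *)
Lemma row_eq_residual (R : pzRingType) (n : nat) (B G : 'M[R]_n) (v : 'I_n -> R)
    (l : 'I_n) :
  (1%:M - B) *m G = 1%:M ->
  v l = \sum_j (v j - \sum_i v i * B i j) * G j l.
Proof.
move=> BG; have := congr1 (fun M : 'M[R]_n => ((\row_i v i) *m M)%R ord0 l) BG.
rewrite mulmx1 mulmxA !mxE => <-; apply: eq_bigr => j _; congr (_ * _).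
rewrite mxE; under eq_bigr do rewrite !mxE mulrBr.
rewrite sumrB (bigD1 j) //= eqxx mulr1 big1 ?addr0 // => i /negPf ij.
by rewrite ij mulr0.
Qed.

(** Fix [k_p = a] and let [x_j] be the total weight of the paths from [p] to
    [j]. Summing the last-step decomposition gives [x = v B], where [v] agrees
    with [x] except that [v_p = (1 + a / alpha) h_a]: a last step out of [p]
    starts either at the origin of the path or at one of the [a] letters [p],
    and the latter configurations are counted by cutting. So the residual
    [v - v B] is supported at [p] and [v = (v_p - x_p) (row p of G)]. Entry
    [p] of this identity, with [alpha x_p = (a + 1) h_(a+1)], is the claim.

    The sums are infinite. On boxes the identity becomes two inequalities; the
    first one and [G >= 0] bound the truncated sums uniformly, so that they
    converge, and both together give the identity in the limit. *)
Lemma mass_balance (R : realType) (n : nat) (alpha : R) (B G : 'M[R]_n) (p : 'I_n)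
    (w : n.-tuple nat -> R) (y : 'I_n -> n.-tuple nat -> R) (h : nat -> R) :
  0 < alpha -> (forall i j, 0 <= B i j) -> (forall i j, 0 <= G i j) ->
  (1%:M - B) *m G = 1%:M ->
  (forall k, 0 <= w k) -> (forall j k, 0 <= y j k) ->
  (forall j k, y j k = B p j * w k +
     \sum_(l | (0 < tnth k l)%N) B l j * y l (decr_at l k)) ->
  (forall k, (0 < tnth k p)%N -> (tnth k p)%:R * w k = alpha * y p (decr_at p k)) ->
  (forall a, ((fun N => \sum_(k <- box n N | tnth k p == a) w k) @ \oo --> h a)
     %classic) ->
  forall a, G p p * (a.+1%:R * h a.+1) = (G p p - 1) * ((alpha + a%:R) * h a).
Proof.
move=> alpha_gt0 B_ge0 G_ge0 BG w_ge0 y_ge0 y_rec w_cut w_cvg a.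
have alpha_neq0 : alpha != 0 by rewrite gt_eqF.
pose W N := \sum_(k <- box n N | tnth k p == a) w k.
pose x l N := \sum_(k <- box n N | tnth k p == a) y l k.
pose S l N := \sum_(k <- box n N | (tnth k p == a) && (0 < tnth k l)%N)
  y l (decr_at l k).
(* [V] is the truncated version of the vector [v]; its limit is [U] below *)
pose V l N := if l == p then (1 + a%:R / alpha) * W N else x l N.
have x_ge0 l N : 0 <= x l N by apply: sumr_ge0.
have W_ge0 N : 0 <= W N by apply: sumr_ge0.
have c_ge0 : 0 <= 1 + a%:R / alpha by rewrite addr_ge0 // divr_ge0 // ltW.
have x_rec j N : x j N = (1 + a%:R / alpha) * W N * B p j +
    \sum_(l | l != p) S l N * B l j.
  have Sp : S p N = a%:R / alpha * W N.
    rewrite /S /W big_mkcondr mulr_sumr; apply: eq_bigr => k /eqP ka.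
    case: ifP => [kp|]; last by rewrite lt0n ka => /negbFE/eqP ->; rewrite !mul0r.
    by apply: (mulfI alpha_neq0); rewrite -w_cut // ka; field.
  rewrite /x (eq_bigr _ (fun k _ => y_rec j k)) big_split /= -mulr_sumr -/(W N).
  have -> : \sum_(k <- box n N | tnth k p == a)
      \sum_(l | (0 < tnth k l)%N) B l j * y l (decr_at l k) = \sum_l S l N * B l j.
    under eq_bigr do rewrite big_mkcond.
    rewrite exchange_big; apply: eq_bigr => l _; rewrite -big_mkcondr mulr_suml.
    by apply: eq_bigr => k _; apply: mulrC.
  by rewrite (bigD1 p) //= Sp; ring.
have S_le l N : l != p -> S l N <= x l N.
  move=> lp; have := @box_sum_decr_le _ _ p l a N _ (y_ge0 l).
  by rewrite [p == l]eq_sym (negPf lp) addn0.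
have S_ge l N : l != p -> x l N <= S l N.+1.
  move=> lp; have := @box_sum_decr_ge _ _ p l a N _ (y_ge0 l).
  by rewrite [p == l]eq_sym (negPf lp) addn0.
have x_le j N : x j N <= \sum_l V l N * B l j.
  rewrite x_rec [leRHS](bigD1 p) //= /V eqxx lerD2l; apply: ler_sum => l lp.
  by rewrite (negPf lp) ler_wpM2r // S_le.
have x_ge j N :
    \sum_l (if l == p then (1 + a%:R / alpha) * W N.+1 else x l N) * B l j <= x j N.+1.
  rewrite x_rec [leLHS](bigD1 p) //= eqxx lerD2l; apply: ler_sum => l lp.
  by rewrite (negPf lp) ler_wpM2r // S_ge.
have W_nd N : W N <= W N.+1 by apply: box_sum_le.
have W_le N : W N <= h a.
  have <- : limn W = h a by apply/cvg_lim => //; exact: w_cvg.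
  apply: nondecreasing_cvgn_le; first exact/nondecreasing_seqP.
  by apply/cvg_ex; exists (h a); exact: w_cvg.
have V_le l N : V l N <= (1 + a%:R / alpha) * h a * G p l.
  apply: (@le_trans _ _ ((1 + a%:R / alpha) * W N * G p l)); last first.
    by rewrite ler_wpM2r // ler_wpM2l.
  rewrite (row_eq_residual (fun i => V i N) _ BG) (bigD1 p) //= -[leRHS]addr0 lerD //.
    rewrite ler_wpM2r // {1}/V eqxx gerBl sumr_ge0 // => i _.
    by rewrite mulr_ge0 // /V; case: eqP => // _; rewrite mulr_ge0.
  apply: sumr_le0 => j jp; rewrite mulr_le0_ge0 // subr_le0.
  by rewrite {1}/V (negPf jp) x_le.
have x_cvg l : exists X : R, (x l @ \oo --> X)%classic.
  apply: (@nondecreasing_bounded_cvg _ _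
    (\sum_i (1 + a%:R / alpha) * h a * G p i * B i l)) => N.
    by apply: box_sum_le.
  by apply: (le_trans (x_le _ _)); apply: ler_sum => i _; rewrite ler_wpM2r.
have [X xX] : exists X : 'I_n -> R, forall l, (x l @ \oo --> X l)%classic.
  by exists (fun l => sval (cid (x_cvg l))) => l; case: (cid _).
have cW : ((fun N => (1 + a%:R / alpha) * W N) @ \oo -->
    (1 + a%:R / alpha) * h a)%classic.
  by apply: cvgM; [apply: cvg_cst | apply: w_cvg].
pose U l := if l == p then (1 + a%:R / alpha) * h a else X l.
have VU l : (V l @ \oo --> U l)%classic.
  by rewrite /V /U; case: eqP => _; [exact: cW | exact: xX].
have X_fix j : X j = \sum_l U l * B l j.
  apply/eqP; rewrite eq_le; apply/andP; split.
    apply: (cvg_seq_le (xX j) _ (x_le j)); apply: cvg_sum => l _.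
    by apply: cvgM; [exact: VU | exact: cvg_cst].
  apply: (@cvg_seq_le _ _ (fun N => x j N.+1) _ _ _ _ (x_ge j)); last first.
    by rewrite (cvg_shiftS (x j)).
  apply: cvg_sum => l _; apply: cvgM; last exact: cvg_cst.
  rewrite /U; case: eqP => _; last exact: xX.
  by rewrite (cvg_shiftS (fun N => (1 + a%:R / alpha) * W N)).
have h_next : a.+1%:R * h a.+1 = alpha * X p.
  have lhs : ((fun N => a.+1%:R * \sum_(k <- box n N | tnth k p == a.+1) w k) @ \oo -->
      a.+1%:R * h a.+1)%classic.
    by apply: cvgM; [exact: cvg_cst | exact: w_cvg].
  have cx : ((fun N => alpha * x p N) @ \oo --> alpha * X p)%classic.
    by apply: cvgM; [exact: cvg_cst | exact: xX].
  have eqS N : a.+1%:R * \sum_(k <- box n N | tnth k p == a.+1) w k =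
    alpha * \sum_(k <- box n N | (tnth k p == a.+1) && (0 < tnth k p)%N)
       y p (decr_at p k).
    rewrite !mulr_sumr; apply: eq_big => [k|k /eqP ka]; first by case: eqP => // ->.
    by rewrite -w_cut ka.
  apply/eqP; rewrite eq_le; apply/andP; split.
    apply: (cvg_seq_le lhs cx) => N; rewrite eqS ler_pM2l //.
    by have := @box_sum_decr_le _ _ p p a N _ (y_ge0 p); rewrite eqxx addn1.
  have lhsS : ((fun N => a.+1%:R * \sum_(k <- box n N.+1 | tnth k p == a.+1) w k) @ \oo
      --> a.+1%:R * h a.+1)%classic.
    apply: cvgM; first exact: cvg_cst.
    rewrite (cvg_shiftS (fun N => \sum_(k <- box n N | tnth k p == a.+1) w k)).
    exact: w_cvg.
  apply: (cvg_seq_le cx lhsS) => N; rewrite eqS ler_pM2l //.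
  by have := @box_sum_decr_ge _ _ p p a N _ (y_ge0 p); rewrite eqxx addn1.
have eqU : U p = (U p - X p) * G p p.
  rewrite {1}(row_eq_residual U p BG) (bigD1 p) //= -X_fix.
  rewrite [X in _ + X]big1 ?addr0 // => j jp.
  by rewrite -X_fix /U (negPf jp) subrr mul0r.
move: eqU; rewrite /U eqxx h_next => eqU.
have -> : (alpha + a%:R) * h a = alpha * ((1 + a%:R / alpha) * h a) by field.
rewrite mulrBl mul1r {2}eqU; ring.
Qed.

(** * Sums over compositions and rising factorials *)

(** Sum of [alpha ^ j_0 * (alpha + 1) ^ j_1 * ...] over the compositions of
    [m] into [l] positive parts, defined by splitting off the last part. *)
Fixpoint composition_sum (R : pzRingType) (alpha : R) (l m : nat) : R :=
  if l is l'.+1 then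
    \sum_(t < m) (alpha + l'%:R) ^+ t.+1 * composition_sum alpha l' (m - t.+1)
  else (m == 0%N)%:R.
Arguments composition_sum {R} alpha l m : simpl never.

Lemma composition_sum0 (R : pzRingType) (alpha : R) (m : nat) :
  composition_sum alpha 0 m = (m == 0%N)%:R.
Proof. by []. Qed.

Lemma composition_sumS (R : pzRingType) (alpha : R) (l m : nat) :
  composition_sum alpha l.+1 m =
  \sum_(t < m) (alpha + l%:R) ^+ t.+1 * composition_sum alpha l (m - t.+1).
Proof. by []. Qed.

(** The last part equals 1, or it can be lowered by 1. *)
Lemma composition_sum_rec (R : pzRingType) (alpha : R) (l m : nat) :
  composition_sum alpha l.+1 m.+1 =
  (alpha + l%:R) * (composition_sum alpha l m + composition_sum alpha l.+1 m).
Proof.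
rewrite !composition_sumS big_ord_recl /= subn1 expr1 mulrDr; congr (_ + _).
by rewrite mulr_sumr; apply: eq_bigr => t _; rewrite mulrA -exprS.
Qed.

Lemma composition_sum_gt (R : pzRingType) (alpha : R) (l m : nat) :
  (m < l)%N -> composition_sum alpha l m = 0.
Proof.
elim: l m => [[]|l IHl m ml] //.
rewrite composition_sumS big1 // => t _; rewrite IHl ?mulr0 //.
by case: t => t /=; lia.
Qed.

(** Both sides are the coefficient of degree [m] of a product of polynomials,
    one for each part; parts larger than [m] do not contribute to it. *)
Lemma composition_sumE (R : comNzRingType) (alpha : R) (l m M : nat) :
  (m <= M)%N ->
  \sum_(j : {ffun 'I_l -> 'I_M.+1} | [forall i, 1 <= j i]%N && (\sum_i j i == m)%N)
     \prod_(i < l) (alpha + i%:R) ^+ j i = composition_sum alpha l m.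
Proof.
pose q i : {poly R} := \sum_(t < M.+1 | (1 <= t)%N) (alpha + i%:R) ^+ t *: 'X^t.
have q_coef : (\prod_(i < l) q i)`_m =
    \sum_(j : {ffun 'I_l -> 'I_M.+1} | [forall i, 1 <= j i]%N && (\sum_i j i == m)%N)
      \prod_(i < l) (alpha + i%:R) ^+ j i.
  rewrite bigA_distr_big coef_sum [RHS]big_mkcond [LHS]big_mkcond.
  apply: eq_bigr => f _; rewrite -[_ \in _]/([forall i, _]).
  case: (boolP [forall i, _]) => //= _.
  rewrite scaler_prod prodrXr coefZ coefXn eq_sym.
  by case: eqP => _; rewrite ?mulr1 ?mulr0.
rewrite -q_coef; elim: l m {q_coef} => [|l IHl] m mM.
  by rewrite big_ord0 coef1 composition_sum0.
rewrite composition_sumS big_ord_recr /= mulr_sumr coef_sum.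
rewrite big_mkcond big_ord_recl /= add0r.
rewrite (big_ord_widen M (fun t => (alpha + l%:R) ^+ t.+1 *
  composition_sum alpha l (m - t.+1)) mM) [RHS]big_mkcond.
apply: eq_bigr => t _; rewrite -scalerAr coefZ coefMXn ltnS.
rewrite /bump /= ?add1n leqNgt; case: ltnP => tm /=; last by rewrite mulr0.
by rewrite IHl // (leq_trans (leq_subr _ _)).
Qed.

Definition rising_ratio (R : fieldType) (alpha : R) (l : nat) (x : R) : R :=
  \prod_(i < l) ((x + alpha + i%:R) / (alpha + i%:R)).

Lemma rising_ratioS (R : fieldType) (alpha : R) (l : nat) (x : R) :
  rising_ratio alpha l.+1 x =
  rising_ratio alpha l x * ((x + alpha + l%:R) / (alpha + l%:R)).
Proof. by rewrite /rising_ratio big_ord_recr. Qed.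

(** This is why rising factorials of [x + alpha] are the right basis: the
    factor [alpha + x] of the balance equation, times the shifted product, is
    again such a product. *)
Lemma rising_ratio_shift (R : realFieldType) (alpha : R) (l : nat) (x : R) :
  0 < alpha ->
  (alpha + x) * rising_ratio alpha l (x + 1) =
  (alpha + l%:R) * rising_ratio alpha l.+1 x.
Proof.
move=> a0; have al i : alpha + i%:R != 0 by rewrite gt_eqF // ltr_wpDr.
elim: l => [|l IHl].
  rewrite rising_ratioS /rising_ratio !big_ord0.
  by field; have := al 0%N; rewrite !addr0.
rewrite [rising_ratio alpha l.+1 (x + 1)]rising_ratioS (mulrA (alpha + x)).
rewrite IHl [in RHS]rising_ratioS.
have := al l; have := al l.+1; rewrite -natr1 => al1 al0.
by field; rewrite al0 al1.
Qed.

(** Newton interpolation of [x ^ m] at the nodes [- alpha - i]: the divided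
    differences are complete homogeneous symmetric polynomials in the
    [alpha + i], up to a sign, and these are [composition_sum] divided by the
    product of all the [alpha + i]. *)
Lemma exprn_rising_ratio (R : realFieldType) (alpha : R) (m : nat) (x : R) :
  0 < alpha ->
  x ^+ m = \sum_(l < m.+1) (-1) ^+ (l + m) * composition_sum alpha l.+1 m.+1
             / (alpha + l%:R) * rising_ratio alpha l x.
Proof.
move=> a0; have al i : alpha + i%:R != 0 by rewrite gt_eqF // ltr_wpDr.
elim: m => [|m IHm].
  rewrite big_ord1 composition_sum_rec composition_sum0 composition_sumS.
  rewrite /rising_ratio !big_ord0 /=.
  by field; rewrite gt_eqF.
rewrite exprS {}IHm mulr_sumr.
transitivity (\sum_(l < m.+1) ((-1) ^+ (l + m) * composition_sum alpha l.+1 m.+1 *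
    (rising_ratio alpha l.+1 x - rising_ratio alpha l x))).
  by apply: eq_bigr => l _; rewrite rising_ratioS; field.
transitivity (\sum_(l < m.+2) ((-1) ^+ (l + m.+1) *
    (composition_sum alpha l m.+1 + composition_sum alpha l.+1 m.+1) *
    rising_ratio alpha l x)); last first.
  by apply: eq_bigr => l _; rewrite [in RHS]composition_sum_rec; field.
under [RHS]eq_bigr do rewrite mulrDr mulrDl.
rewrite [RHS]big_split /= [X in _ = X + _]big_ord_recl [X in _ = _ + X]big_ord_recr.
rewrite [composition_sum alpha m.+2 m.+1]composition_sum_gt //.
rewrite composition_sum0 /= !(mulr0n, mulr0, mul0r, add0r, addr0).
rewrite -big_split /=; apply: eq_bigr => l _.
rewrite /bump /= !add1n addSn addnS !exprS; ring.
Qed.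

(** * Moments from the balance equation *)

(** The balance equation determines a negative binomial law. Tested against
    the product of index [l] it says [c b_l = (c - 1) (alpha + l) a_(l+1)] for
    the expectations [a_l] of the products and [b_l] of [j] times the products,
    while [(alpha + l) a_(l+1) = b_l + (alpha + l) a_l] by definition. Hence
    [a_l = c ^ l] by induction. The same relation between partial sums, where
    the left side has one more term, bounds the partial sums of [b_l] and so
    yields their convergence. *)
Lemma rising_ratio_moments (R : realType) (alpha c : R) (h : nat -> R) :
  0 < alpha -> 1 <= c -> (forall j, 0 <= h j) ->
  (forall j, c * (j.+1%:R * h j.+1) = (c - 1) * ((alpha + j%:R) * h j)) ->
  ((fun N => \sum_(j < N) h j) @ \oo --> (1 : R))%classic ->
  forall l,
  ((fun N => \sum_(j < N) rising_ratio alpha l j%:R * h j) @ \oo --> c ^+ l)%classic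
  /\ ((fun N => \sum_(j < N) j%:R * rising_ratio alpha l j%:R * h j) @ \oo -->
       (alpha + l%:R) * (c - 1) * c ^+ l)%classic.
Proof.
move=> a0 c1 h0 h_rec h_sum.
have al i : 0 < alpha + i%:R by rewrite ltr_wpDr.
have r_ge0 l (j : nat) : 0 <= rising_ratio alpha l j%:R.
  apply: prodr_ge0 => i _; rewrite divr_ge0 ?(ltW (al _)) //.
  by rewrite -addrA addr_ge0 // ltW.
pose A l N := \sum_(j < N) rising_ratio alpha l j%:R * h j.
pose B l N := \sum_(j < N) j%:R * rising_ratio alpha l j%:R * h j.
have A_next l N : A l.+1 N = A l N + B l N / (alpha + l%:R).
  rewrite /A /B mulr_suml -big_split /=; apply: eq_bigr => j _.
  by rewrite rising_ratioS; field; rewrite gt_eqF.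
have B_next l N : c * B l N.+1 = (c - 1) * (alpha + l%:R) * A l.+1 N.
  rewrite /B big_ord_recl !mul0r add0r mulr_sumr /A mulr_sumr.
  apply: eq_bigr => j _; rewrite /= /bump /= add1n.
  have -> : c * (j.+1%:R * rising_ratio alpha l j.+1%:R * h j.+1) =
     c * (j.+1%:R * h j.+1) * rising_ratio alpha l j.+1%:R by ring.
  rewrite h_rec -natr1 mulrACA.
  have -> : (c - 1) * ((alpha + j%:R) * h j) * rising_ratio alpha l (j%:R + 1) =
     (c - 1) * ((alpha + j%:R) * rising_ratio alpha l (j%:R + 1)) * h j by ring.
  by rewrite rising_ratio_shift //; ring.
have B_lim l : (A l @ \oo --> c ^+ l)%classic ->
    (B l @ \oo --> (alpha + l%:R) * (c - 1) * c ^+ l)%classic.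
  move=> A_lim.
  have A_le N : A l N <= c ^+ l.
    have <- : limn (A l) = c ^+ l by apply/cvg_lim.
    apply: nondecreasing_cvgn_le; last by apply/cvg_ex; exists (c ^+ l).
    apply/nondecreasing_seqP => M; rewrite /A big_ord_recr /= lerDl.
    by rewrite mulr_ge0.
  have B_nd N : B l N <= B l N.+1.
    by rewrite /B big_ord_recr /= lerDl !mulr_ge0.
  have B_rec N : c * B l N.+1 = (c - 1) * ((alpha + l%:R) * A l N + B l N).
    by rewrite B_next A_next; field; rewrite gt_eqF.
  have B_le N : B l N <= (c - 1) * ((alpha + l%:R) * c ^+ l).
    have : c * B l N <= c * B l N.+1 by rewrite ler_wpM2l // (le_trans ler01).
    rewrite B_rec => le1.
    have : (c - 1) * ((alpha + l%:R) * A l N) <= (c - 1) * ((alpha + l%:R) * c ^+ l).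
      by rewrite ler_wpM2l ?subr_ge0 // ler_wpM2l // ltW.
    by move: le1; lra.
  have [b B_cvg] := nondecreasing_bounded_cvg B_nd B_le.
  suff <- : b = (alpha + l%:R) * (c - 1) * c ^+ l by [].
  have lhs : ((fun N => c * B l N.+1) @ \oo --> c * b)%classic.
    by apply: cvgM; [exact: cvg_cst | rewrite (cvg_shiftS (B l))].
  have rhs : ((fun N => c * B l N.+1) @ \oo -->
      (c - 1) * ((alpha + l%:R) * c ^+ l + b))%classic.
    under eq_fun do rewrite B_rec.
    apply: cvgM; [exact: cvg_cst | apply: cvgD => //].
    by apply: cvgM; [exact: cvg_cst |].
  have eqb := cvg_unique _ lhs rhs.
  have {}eqb := eqb (@Rhausdorff R).
  by transitivity (c * b - (c - 1) * b); [ring | rewrite eqb; ring].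
have A_lim l : (A l @ \oo --> c ^+ l)%classic.
  elim: l => [|l IHl].
    rewrite expr0; rewrite (_ : A 0%N = fun N => \sum_(j < N) h j) //.
    apply/funext => N; apply: eq_bigr => j _.
    by rewrite /rising_ratio big_ord0 mul1r.
  have -> : c ^+ l.+1 = c ^+ l + (alpha + l%:R) * (c - 1) * c ^+ l / (alpha + l%:R).
    by rewrite exprS; field; rewrite gt_eqF.
  rewrite (_ : A l.+1 = fun N => A l N + B l N / (alpha + l%:R)); last first.
    by apply/funext => N; rewrite A_next.
  apply: cvgD => //; apply: cvgM; [exact: B_lim | exact: cvg_cst].
by move=> l; split; [exact: A_lim | exact/B_lim/A_lim].
Qed.

Lemma power_moments (R : realType) (alpha c : R) (h : nat -> R) :
  0 < alpha -> 1 <= c -> (forall j, 0 <= h j) ->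
  (forall j, c * (j.+1%:R * h j.+1) = (c - 1) * ((alpha + j%:R) * h j)) ->
  ((fun N => \sum_(j < N) h j) @ \oo --> (1 : R))%classic ->
  forall m,
  ((fun N => \sum_(j < N) j%:R ^+ m.+1 * h j) @ \oo -->
    \sum_(l < m.+1) (-1) ^+ (l + m) * composition_sum alpha l.+1 m.+1 *
      (c ^+ l * (c - 1)))%classic.
Proof.
move=> a0 c1 h0 h_rec h_sum m.
have al i : alpha + i%:R != 0 by rewrite gt_eqF // ltr_wpDr.
pose coef l := (-1) ^+ (l + m) * composition_sum alpha l.+1 m.+1 / (alpha + l%:R).
rewrite (_ : (fun _ => _) = fun N => \sum_(l < m.+1) coef l *
    \sum_(j < N) j%:R * rising_ratio alpha l j%:R * h j); last first.
  apply/funext => N; under [RHS]eq_bigr do rewrite mulr_sumr.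
  rewrite exchange_big; apply: eq_bigr => j _.
  rewrite exprS (exprn_rising_ratio _ _ a0) mulr_sumr mulr_suml.
  by apply: eq_bigr => l _; rewrite /coef; field.
rewrite (eq_bigr (fun l : 'I_m.+1 =>
    coef l * ((alpha + l%:R) * (c - 1) * c ^+ l))); last first.
  by move=> l _; rewrite /coef; field.
apply: cvg_sum => l _; apply: cvgM; first exact: cvg_cst.
by have [] := rising_ratio_moments a0 c1 h0 h_rec h_sum l.
Qed.

(** * Laws and expectations of integer-valued random variables *)

Lemma ge0_expectation_nat (R : realType) (d : measure_display)
    (T : measurableType d) (P : probability T R) (X : T -> nat) (f : nat -> R) :
  measurable_fun setT X -> (forall j, 0 <= f j) ->
  ('E_P[(f \o X)%R] =
   \sum_(0 <= j <oo) (f j * fine (P (X @^-1` [set j])%classic))%:E)%E.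
Proof.
move=> mX f0.
have mXj j : measurable (X @^-1` [set j])%classic.
  by rewrite -[X in measurable X]setTI; exact: mX.
rewrite unlock.
have -> : [set: T]%classic = (\bigcup_j (X @^-1` [set j]))%classic.
  by apply/seteqP; split => // w _; exists (X w).
rewrite ge0_integral_bigcup //.
- apply: eq_eseriesr => j _.
  rewrite (eq_integral (cst (f j)%:E)) => [|w]; last by rewrite inE => /= ->.
  by rewrite integral_cst // EFinM fineK // fin_num_measure.
- apply: (measurable_funS measurableT) => //.
  (* every set of natural numbers is measurable *)
  by move=> _ Y _; exact: (mX measurableT ((fun j => (f j)%:E) @^-1` Y)%classic I).
- by move=> w _; rewrite lee_fin; exact: f0.
- by move=> i j _ _ [w [/= <- <-]].
Qed.

(** Expectations are series of extended reals, the moment computation is about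
    real limits; nonnegativity makes the two equivalent. *)
Lemma eseries_cvg (R : realType) (u : nat -> R) (l : R) : (forall j, 0 <= u j) ->
  (\sum_(0 <= j <oo) (u j)%:E = l%:E)%E <->
  ((fun N => \sum_(j < N) u j) @ \oo --> l)%classic.
Proof.
move=> u0.
have sumE : (fun N => \sum_(0 <= j < N) (u j)%:E)%E =
    EFin \o (fun N => \sum_(j < N) u j).
  by apply/funext => N; rewrite /= big_mkord sumEFin.
split => [ul|ul]; last first.
  by rewrite sumE; apply/cvg_lim => //; apply: cvg_EFin => //; exact: nearW.
have := @is_cvg_nneseries _ (fun j => (u j)%:E) xpredT 0%N.
rewrite sumE => /(_ (fun j _ _ => u0 j)) u_cvg.
have : ((EFin \o (fun N => \sum_(j < N) u j)) @ \oo --> l%:E)%classic.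
  by rewrite -ul sumE.
by move/fine_cvgP => [].
Qed.

Lemma measurable_tuple_set1 (n : nat) (k : n.-tuple nat) : measurable [set k]%classic.
Proof.
have -> : [set k]%classic =
    (\bigcap_(i in [set: 'I_n]) ((@tnth n nat)^~ i @^-1` [set tnth k i]))%classic.
  apply/seteqP; split => [_ -> //|k' kk']; apply: eq_from_tnth => i.
  exact: kk'.
apply: fin_bigcap_measurable => [|i _]; first exact: finite_finset.
by rewrite -[X in measurable X]setTI; exact: measurable_tnth.
Qed.

(** The event that coordinate [p] equals [a] is the increasing union of the
    events that moreover the whole vector lies in a box. *)
Lemma box_law_cvg (R : realType) (n : nat) (d : measure_display)
    (T : measurableType d) (P : probability T R) (Z : {RV P >-> n.-tuple nat})
    (mass : n.-tuple nat -> R) (p : 'I_n) (a : nat) :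
  (forall k, distribution P Z [set k]%classic = (mass k)%:E) ->
  ((fun N => \sum_(k <- box n N | tnth k p == a) mass k) @ \oo -->
   fine (P ((fun w => tnth (Z w) p) @^-1` [set a])%classic))%classic.
Proof.
move=> Z_law.
have mk (k : n.-tuple nat) : measurable (Z @^-1` [set k])%classic.
  by rewrite -[X in measurable X]setTI; apply: measurable_funPT => //;
    exact: measurable_tuple_set1.
have ms (s : seq (n.-tuple nat)) : measurable (Z @^-1` [set k | k \in s])%classic.
  elim: s => [|k s IHs].
    by rewrite (_ : _ @^-1` _ = set0)%classic //; apply/seteqP; split.
  rewrite (_ : _ @^-1` _ = Z @^-1` [set k] `|` Z @^-1` [set k | k \in s])%classic.
    exact: measurableU.
  apply/seteqP; split => w /=; rewrite inE; first by case/orP => [/eqP|]; [left|right].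
  by case=> [->|->]; rewrite ?eqxx ?orbT.
have Ps (s : seq (n.-tuple nat)) : uniq s ->
    (P (Z @^-1` [set k | k \in s]) = (\sum_(k <- s) mass k)%:E)%classic.
  elim: s => [_|k s IHs /= /andP[ks us]].
    rewrite big_nil (_ : _ @^-1` _ = set0)%classic ?measure0 //.
    by apply/seteqP; split.
  rewrite (_ : _ @^-1` _ = Z @^-1` [set k] `|` Z @^-1` [set k | k \in s])%classic.
    rewrite measureU //; first by rewrite big_cons EFinD; congr (_ + _)%E;
      [exact: Z_law | exact: IHs].
    by apply/seteqP; split => // w /= [-> ]; rewrite (negPf ks).
  apply/seteqP; split => w /=; rewrite inE; first by case/orP => [/eqP|]; [left|right].
  by case=> [->|->]; rewrite ?eqxx ?orbT.
pose E N := (Z @^-1` [set k | k \in [seq k <- box n N | tnth k p == a]])%classic.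
have E_cup : (\bigcup_N E N = (fun w => tnth (Z w) p) @^-1` [set a])%classic.
  apply/seteqP; split => w /=.
    by case=> N _; rewrite /E /= mem_filter => /andP[/eqP].
  move=> Zw; exists (\max_i tnth (Z w) i)%N => //=.
  rewrite /E /= mem_filter Zw eqxx mem_box; apply/forallP => i.
  exact: leq_bigmax.
have : ((P \o E) @ \oo --> P (\bigcup_N E N)%classic)%classic.
  apply: nondecreasing_cvg_mu => [N||].
  - exact: ms.
  - by apply: bigcupT_measurable => N; exact: ms.
  - move=> N M NM; apply/subsetPset => w; rewrite /E /= !mem_filter !mem_box.
    move=> /andP[-> /forallP wN]; apply/forallP => i; exact: leq_trans (wN i) NM.
rewrite E_cup -[X in (_ --> X)%classic]fineK ?fin_num_measure //; last first.
  by rewrite -E_cup; apply: bigcupT_measurable => N; exact: ms.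
move/fine_cvgP => [_]; apply: cvg_trans; apply: near_eq_cvg; apply: nearW => N /=.
by rewrite Ps ?filter_uniq ?box_uniq //= big_filter.
Qed.

(** * The M-matrix and the moment formula *)

(** If [A i i <= 0], all terms of entry [(i, i)] of [A A^-1] are nonpositive,
    but this entry is 1. *)
Lemma M_matrix_diag_gt0 (R : realType) (n : nat) (A : 'M[R]_n) (i : 'I_n) :
  nonsingular_M_matrix A -> 0 < A i i.
Proof.
move=> [A_off A_unit A_inv]; rewrite ltNge; apply/negP => Aii.
have /matrixP/(_ i i) := mulmxV A_unit; rewrite !mxE eqxx => eq1.
suff : \sum_j A i j * invmx A j i <= 0 by rewrite eq1 ler10.
apply: sumr_le0 => j _; apply: mulr_le0_ge0 => //.
by case: (eqVneq i j) => [<- //|ij]; apply: A_off.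
Qed.

Lemma diag_part_unit (R : realType) (n : nat) (A : 'M[R]_n) :
  nonsingular_M_matrix A -> diag_part A \in unitmx.
Proof.
move=> A_M; rewrite unitmxE det_diag unitfE; apply/prodf_neq0 => i _.
by rewrite mxE gt_eqF // M_matrix_diag_gt0.
Qed.

Lemma scaled_offdiagE (R : realType) (n : nat) (A : 'M[R]_n) :
  nonsingular_M_matrix A -> 1%:M - scaled_offdiag A = scaled_mx A.
Proof.
move=> A_M; rewrite /scaled_offdiag mulmxBr mulVmx ?diag_part_unit //.
by rewrite opprB addrC subrK.
Qed.

Lemma scaled_offdiag_ge0 (R : realType) (n : nat) (A : 'M[R]_n) (i j : 'I_n) :
  nonsingular_M_matrix A -> 0 <= scaled_offdiag A i j.
Proof.
move=> A_M; have [A_off _ _] := A_M; have Aii := M_matrix_diag_gt0 i A_M.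
rewrite -(pmulr_rge0 _ Aii).
have /matrixP/(_ i j) : diag_part A *m scaled_offdiag A = diag_part A - A.
  by rewrite mulmxA mulmxV ?mul1mx ?diag_part_unit.
rewrite /diag_part mul_diag_mx !mxE => ->.
case: (eqVneq i j) => [->|ij]; first by rewrite mulr1n subrr.
by rewrite mulr0n sub0r oppr_ge0 A_off.
Qed.

Theorem lemma1p3 (R : realType) (n : nat) (alpha : R) (A : 'M[R]_n)
    (d : measure_display) (T : measurableType d) (P : probability T R)
    (Z : {RV P >-> n.-tuple nat})
    (alpha_gt0 : 0 < alpha)
    (A_Mmatrix : nonsingular_M_matrix A)
    (Z_law : forall k : n.-tuple nat,
       distribution P Z [set k]%classic = (permanental_pmf alpha A k)%:E)
    (m : nat) (m_ge1 : (1 <= m)%N) (p : 'I_n) :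
  'E_P[(fun w : T => (tnth (Z w) p)%:R ^+ m)%R]%E =
  (\sum_(l < m)
     \sum_(j : {ffun 'I_l.+1 -> 'I_m.+1}
           | [forall i, 1 <= j i]%N && (\sum_i j i == m)%N)
       (-1) ^+ (l + m + 1) * (\prod_(i < l.+1) (alpha + i%:R) ^+ j i)
       * (invmx A p p * A p p) ^+ l * (invmx A p p * A p p - 1))%:E.
Proof.
have [A_off A_unit A_inv] := A_Mmatrix.
set c := invmx A p p * A p p.
set B := scaled_offdiag A; pose G := invmx A *m diag_part A.
have B_ge0 i j : 0 <= B i j by apply: scaled_offdiag_ge0.
have GE i j : G i j = invmx A i j * A j j by rewrite /G mul_mx_diag !mxE.
have G_ge0 i j : 0 <= G i j by rewrite GE mulr_ge0 // ltW // M_matrix_diag_gt0.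
have BG : (1%:M - B) *m G = 1%:M.
  rewrite scaled_offdiagE // /scaled_mx /G -mulmxA (mulmxA A) mulmxV // mul1mx.
  by rewrite mulVmx // diag_part_unit.
(* [G = 1 + B G], and [B G] is nonnegative *)
have c_ge1 : 1 <= c.
  rewrite /c -GE; move/matrixP/(_ p p): BG; rewrite mulmxBl mul1mx !mxE eqxx.
  move/eqP; rewrite subr_eq => /eqP ->; rewrite lerDl.
  by apply: sumr_ge0 => i _; rewrite mulr_ge0.
have mX : measurable_fun [set: T]%classic (fun w => tnth (Z w) p).
  apply: (measurableT_comp (measurable_tnth p)); exact: measurable_funPT.
pose h a := fine (P ((fun w => tnth (Z w) p) @^-1` [set a])%classic).
have h_ge0 a : 0 <= h a by rewrite fine_ge0.
pose C := \det (scaled_mx A) `^ alpha.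
have C_ge0 : 0 <= C by apply: powR_ge0.
have h_rec a : c * (a.+1%:R * h a.+1) = (c - 1) * ((alpha + a%:R) * h a).
  rewrite /c -GE; apply: (@mass_balance _ _ _ B G p (fun k => C * cycle_mass alpha B k)
    (fun j k => C * path_mass alpha B p j k) h) => // [k|j k|j k|k kp|b].
  - by rewrite mulr_ge0 // cycle_mass_ge0 // ltW.
  - by rewrite mulr_ge0 // path_mass_ge0 // ltW.
  - rewrite path_mass_rec ?gt_eqF // mulrDr mulrCA; congr (_ + _).
    by rewrite mulr_sumr; apply: eq_bigr => l _; rewrite mulrCA.
  - by rewrite mulrCA cycle_mass_cut ?gt_eqF // mulrCA.
  - exact: (@box_law_cvg _ _ _ _ P Z (fun k => C * cycle_mass alpha B k)).
(* the law has total mass 1: take the expectation of the constant 1 *)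
have h_sum : ((fun N => \sum_(j < N) h j) @ \oo --> (1 : R))%classic.
  apply/(eseries_cvg _ h_ge0).
  have := ge0_expectation_nat P (f := fun=> 1) mX (fun=> ler01).
  by rewrite expectation_cst => ->; apply: eq_eseriesr => j _; rewrite mul1r.
case: m m_ge1 => // m _.
rewrite (ge0_expectation_nat P (f := fun j => j%:R ^+ m.+1) mX); last first.
  by move=> j; rewrite exprn_ge0.
have pow_ge0 j : 0 <= j%:R ^+ m.+1 * h j by rewrite mulr_ge0 ?exprn_ge0.
have pow_cvg := @power_moments _ _ _ _ alpha_gt0 c_ge1 h_ge0 h_rec h_sum m.
rewrite (proj2 (eseries_cvg _ pow_ge0) pow_cvg).
congr EFin; apply: eq_bigr => l _.
rewrite -(composition_sumE alpha l.+1 (leqnn m.+1)) mulr_sumr mulr_suml.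
apply: eq_bigr => j _; rewrite -addnA addn1 !addnS !exprS !mulN1r opprK; ring.
Qed.
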